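(* For $n\ge1$ and $0\le k\le n-1$ let $a_{n,k}$ be the number of $2$-pop-stack-sortable permutations of size $n$ with exactly $k$ ascents. Then for every $k\ge 0$, $$\sum_{n\ge0}a_{2n+k+1,n+k}x^n=\sqrt{\frac{1+x}{1-7x}}\left(\frac{1-x-\sqrt{(1+x)(1-7x)}}{2x}\right)^k,\qquad \sum_{n\ge0}a_{2n+k+1,n}x^n=\sqrt{\frac{1+x}{1-7x}}\left(\frac{1-x-\sqrt{(1+x)(1-7x)}}{2x(1+2x)}\right)^k.$$ Moreover, for $n\ge1$, $$a_{2n+1,n}=\sum_{i=0}^{n-1}(-1)^i2^{n-i}\binom{2(n-i)}{n-i}\binom{n-1}{i}=\sum_{k\ge0}\binom{n}{2k}\binom{2k}{k}2^{2k+1}3^{n-2k-1}\Big(2-\frac{k}{n}\Big).$$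
   Context: For a permutation $a_1\ldots a_n$, an ascent is an index $i$ with $a_i<a_{i+1}$. Falls are maximal decreasing strings of consecutive entries; the flip $T$ reverses every fall in place. A permutation $\pi$ is $2$-pop-stack-sortable if $T(T(\pi))$ is the identity permutation. *)

(* Defs.v *)
From HB Require Import structures.
From mathcomp Require Import all_boot all_order all_algebra all_fingroup.
From mathcomp Require Import boolp.

Set Implicit Arguments.
Unset Strict Implicit.
Unset Printing Implicit Defensive.

Import GRing.Theory.

(* One-line notation, with entries 0, ..., n - 1. *)
Definition word n (s : 'S_n) : seq nat := [seq val (s i) | i <- enum 'I_n].

Definition ascents (w : seq nat) : seq nat :=
  [seq i <- iota 0 (size w).-1 | nth 0 w i < nth 0 w i.+1].

Fixpoint falls (w : seq nat) : seq (seq nat) :=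
  if w is x :: w' then
    match falls w' with
    | (y :: r) :: fs =>
        if y < x then (x :: y :: r) :: fs else [:: x] :: (y :: r) :: fs
    | fs => [:: x] :: fs
    end
  else [::].

Definition flip (w : seq nat) : seq nat := flatten [seq rev r | r <- falls w].

Definition pop2_sortable n (s : 'S_n) : bool :=
  flip (flip (word s)) == word (1%g : 'S_n).

Definition pop2_count (n k : nat) : nat :=
  #|[set s : 'S_n | pop2_sortable s & size (ascents (word s)) == k]|.

Lemma flatten_falls w : flatten (falls w) = w.
Proof.
elim: w => //= x w; case: (falls w) => [|[|y r] fs] /= <- //.
by case: ifP.
Qed.

Lemma falls_nonempty w : all (fun r => r != [::]) (falls w).
Proof.
elim: w => //= x w; case: (falls w) => [|[|y r] fs] //= fs_ok.
by case: ifP.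
Qed.

Lemma falls_decreasing w : all (sorted gtn) (falls w).
Proof.
elim: w => //= x w; case: (falls w) => [|[|y r] fs] //= /andP[yr fs_dec].
by case: ifP => /= [->|_]; rewrite yr.
Qed.

(* Each fall is maximal: its last entry does not exceed the first entry of the
   next fall. *)
Lemma falls_maximal w :
  sorted (fun r1 r2 => last 0 r1 <= head 0 r2) (falls w).
Proof.
elim: w => //= x w; have := falls_nonempty w.
case: (falls w) => [|[|y r] fs] //= _.
by case: (ltnP y x) => [_|/= -> //]; case: fs.
Qed.

Local Open Scope ring_scope.

(* Formal power series, represented by their coefficient sequences. *)
Record fps (R : Type) := Fps { coefs : nat -> R }.

Section FpsRing.
Variable F : fieldType.
Implicit Types f g h : fps F.

Lemma fpsP f g : coefs f =1 coefs g -> f = g.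
Proof. by case: f g => [f] [g] /= /funext ->. Qed.

HB.instance Definition _ := gen_eqMixin (fps F).
HB.instance Definition _ := gen_choiceMixin (fps F).

Definition fps_zero : fps F := Fps (fun=> 0).
Definition fps_opp f := Fps (fun n => - coefs f n).
Definition fps_add f g := Fps (fun n => coefs f n + coefs g n).

Fact fps_addA : associative fps_add.
Proof. by move=> f g h; apply/fpsP => n /=; rewrite addrA. Qed.
Fact fps_addC : commutative fps_add.
Proof. by move=> f g; apply/fpsP => n /=; rewrite addrC. Qed.
Fact fps_add0 : left_id fps_zero fps_add.
Proof. by move=> f; apply/fpsP => n /=; rewrite add0r. Qed.
Fact fps_addN : left_inverse fps_zero fps_opp fps_add.
Proof. by move=> f; apply/fpsP => n /=; rewrite addNr. Qed.

HB.instance Definition _ :=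
  GRing.isZmodule.Build (fps F) fps_addA fps_addC fps_add0 fps_addN.

Definition fps_one : fps F := Fps (fun n => (n == 0)%:R).
Definition fps_mul f g :=
  Fps (fun n => \sum_(i < n.+1) coefs f i * coefs g (n - i)%N).

Let trunc m f : {poly F} := \poly_(i < m) coefs f i.

Fact fps_mulE f g m n : (n < m)%N ->
  coefs (fps_mul f g) n = (trunc m f * trunc m g)`_n.
Proof.
move=> ltnm; rewrite coefM /=; apply: eq_bigr => i _.
by rewrite !coef_poly (leq_ltn_trans (leq_subr _ _) ltnm)
  (leq_ltn_trans _ ltnm) // -ltnS.
Qed.

Fact fps_mulC : commutative fps_mul.
Proof. by move=> f g; apply/fpsP => n; rewrite !(@fps_mulE _ _ n.+1) // mulrC. Qed.

Fact fps_mulA : associative fps_mul.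
Proof.
move=> f g h; apply/fpsP => n.
transitivity (trunc n.+1 f * (trunc n.+1 g * trunc n.+1 h))`_n.
  rewrite coefM; apply: eq_bigr => i _.
  by rewrite (@fps_mulE _ _ n.+1) ?ltnS ?leq_subr // coef_poly ltn_ord.
rewrite mulrA coefM; apply: eq_bigr => i _.
by rewrite (@fps_mulE _ _ n.+1) // coef_poly ltnS leq_subr.
Qed.

Fact fps_mul1 : left_id fps_one fps_mul.
Proof.
move=> f; apply/fpsP => n /=; rewrite big_ord_recl /= mul1r subn0.
by rewrite big1 ?addr0 // => i _; rewrite mul0r.
Qed.

Fact fps_mulDl : left_distributive fps_mul fps_add.
Proof.
move=> f g h; apply/fpsP => n /=; rewrite -big_split.
by apply: eq_bigr => i _; rewrite mulrDl.
Qed.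

Fact fps_one_neq0 : fps_one != 0.
Proof.
by apply/eqP => /(congr1 (fun f => coefs f 0)) /= /eqP; rewrite oner_eq0.
Qed.

HB.instance Definition _ := GRing.Zmodule_isComNzRing.Build (fps F)
  fps_mulA fps_mulC fps_mul1 fps_mulDl fps_one_neq0.

Lemma coefs0 n : coefs (0 : fps F) n = 0. Proof. by []. Qed.
Lemma coefs1 n : coefs (1 : fps F) n = (n == 0%N)%:R. Proof. by []. Qed.
Lemma coefsD f g n : coefs (f + g) n = coefs f n + coefs g n.
Proof. by []. Qed.
Lemma coefsN f n : coefs (- f) n = - coefs f n. Proof. by []. Qed.
Lemma coefsM f g n :
  coefs (f * g) n = \sum_(i < n.+1) coefs f i * coefs g (n - i)%N.
Proof. by []. Qed.

Definition fpsX : fps F := Fps (fun n => (n == 1)%:R).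

Lemma coefsXM f n : coefs (fpsX * f) n = if n is m.+1 then coefs f m else 0.
Proof.
rewrite coefsM; case: n => [|n]; first by rewrite big_ord1 mul0r.
rewrite 2!big_ord_recl mul0r add0r /= mul1r subSS subn0.
by rewrite big1 ?addr0 // => i _; rewrite mul0r.
Qed.

Fixpoint fps_inv_seq f n : seq F :=
  if n is m.+1 then
    let s := fps_inv_seq f m in
    rcons s ((coefs f 0)^-1 *
      ((m == 0)%:R - \sum_(i < m) coefs f (m - i)%N * s`_i))
  else [::].

Definition fps_unit : {pred fps F} := [pred f | coefs f 0 != 0].

(* In a unit ring the inverse of a non-unit is itself, by convention. *)
Definition fps_inv f :=
  if f \in fps_unit then Fps (fun n => (fps_inv_seq f n.+1)`_n) else f.

Fact size_fps_inv_seq f n : size (fps_inv_seq f n) = n.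
Proof. by elim: n => //= n IHn; rewrite size_rcons IHn. Qed.

Fact nth_fps_inv_seq f n i : (i < n)%N ->
  (fps_inv_seq f n)`_i = (fps_inv_seq f i.+1)`_i.
Proof.
elim: n => // n IHn; rewrite ltnS leq_eqVlt => /orP[/eqP -> //|ltin].
by rewrite [LHS]/= nth_rcons size_fps_inv_seq ltin IHn.
Qed.

Fact fps_mulV : {in fps_unit, left_inverse 1 fps_inv *%R}.
Proof.
move=> f fU; rewrite mulrC; apply/fpsP => n.
rewrite coefsM coefs1 /fps_inv fU /=.
rewrite (reindex_inj rev_ord_inj) big_ord_recr /= subSS subnn subn0.
rewrite nth_rcons size_fps_inv_seq ltnn eqxx mulVKf //.
rewrite addrC -addrA [X in _ + X = _](_ : _ = 0) ?addr0 //.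
apply/eqP; rewrite addrC subr_eq0; apply/eqP; apply: eq_bigr => i _ /=.
have lein : (i <= n)%N by exact: ltnW.
by rewrite subSS subKn // -/(fps_inv_seq f i.+1) (nth_fps_inv_seq f (ltn_ord i)).
Qed.

Fact fps_unitPl f g : g * f = 1 -> fps_unit f.
Proof.
move=> /(congr1 (fun h => coefs h 0)); rewrite coefsM coefs1 big_ord1 /=.
by apply: contra_eq_neq => ->; rewrite mulr0 eq_sym oner_eq0.
Qed.

Fact fps_inv_out : {in [predC fps_unit], fps_inv =1 id}.
Proof. by move=> f; rewrite inE /fps_inv => /negPf ->. Qed.

HB.instance Definition _ := GRing.ComNzRing_hasMulInverse.Build (fps F)
  fps_mulV fps_unitPl fps_inv_out.

Fact fps_lowest f : f != 0 ->
  exists2 m, coefs f m != 0 & forall i, (i < m)%N -> coefs f i = 0.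
Proof.
move=> nzf; have: exists m, coefs f m != 0.
  apply: contrapT => nof; case/eqP: nzf; apply/fpsP => n.
  by apply: contrapT => /eqP nzn; apply: nof; exists n.
move=> exf; case: (ex_minnP exf) => m nzm minm.
exists m => // i; apply: contraTeq => /minm; by rewrite leqNgt.
Qed.

Fact fps_integral : GRing.integral_domain_axiom (fps F).
Proof.
move=> f g fg0; apply: contraT; rewrite negb_or => /andP[].
move=> /fps_lowest[p nzp ltp] /fps_lowest[q nzq ltq].
move/(congr1 (fun h => coefs h (p + q)%N)): fg0.
rewrite coefsM coefs0 (bigD1 (Ordinal (leq_addr q p : (p < (p + q).+1)%N))) //=.
rewrite addKn big1 ?addr0 => [/eqP|i neip].
  by rewrite mulf_eq0 (negPf nzp) (negPf nzq).
have [ltip|ltpi|eqip] := ltngtP i p.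
- by rewrite ltp // mul0r.
- by rewrite ltq ?mulr0 // ltn_subLR ?ltn_add2r // -ltnS.
- by case/eqP: neip; apply: val_inj.
Qed.

HB.instance Definition _ := GRing.ComUnitRing_isIntegral.Build (fps F)
  fps_integral.

(* The square root with constant term 1 of a series with constant term 1 (see
   fps_sqrtK): its coefficients satisfy
   2 h_n + sum_(0 < i < n) h_i h_(n - i) = f_n for n > 0. *)
Fixpoint fps_sqrt_seq f n : seq F :=
  if n is m.+1 then
    let s := fps_sqrt_seq f m in
    rcons s (if m == 0 then 1
             else (coefs f m - \sum_(1 <= i < m) s`_i * s`_(m - i)) / 2)
  else [::].

Definition fps_sqrt f := Fps (fun n => (fps_sqrt_seq f n.+1)`_n).

Lemma fps_sqrt0 f : coefs (fps_sqrt f) 0 = 1. Proof. by []. Qed.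

Fact size_fps_sqrt_seq f n : size (fps_sqrt_seq f n) = n.
Proof. by elim: n => //= n IHn; rewrite size_rcons IHn. Qed.

Fact nth_fps_sqrt_seq f n i : (i < n)%N ->
  (fps_sqrt_seq f n)`_i = coefs (fps_sqrt f) i.
Proof.
elim: n => // n IHn; rewrite ltnS leq_eqVlt => /orP[/eqP -> //|ltin].
by rewrite [LHS]/= nth_rcons size_fps_sqrt_seq ltin IHn.
Qed.

Lemma fps_sqrtK f : (2 : F) != 0 -> coefs f 0 = 1 -> fps_sqrt f ^+ 2 = f.
Proof.
move=> nz2 f0; apply/fpsP => -[|n].
  by rewrite expr2 coefsM big_ord1 fps_sqrt0 mulr1 f0.
rewrite expr2 coefsM -(big_mkord xpredT (fun i =>
  coefs (fps_sqrt f) i * coefs (fps_sqrt f) (n.+1 - i))).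
rewrite big_nat_recr // big_ltn // subn0 subnn !fps_sqrt0 mul1r mulr1.
rewrite [LHS]addrAC -mulr2n -mulr_natr.
rewrite [coefs (fps_sqrt f) n.+1]/= nth_rcons size_rcons size_fps_sqrt_seq.
rewrite ltnn eqxx divfK // -/(fps_sqrt_seq f n.+1).
rewrite (_ : \sum_(1 <= i < n.+1) _ = \sum_(1 <= i < n.+1)
   coefs (fps_sqrt f) i * coefs (fps_sqrt f) (n.+1 - i)) ?subrK //.
rewrite !big_nat; apply: eq_bigr => i /andP[i_gt0 ltin].
by rewrite !nth_fps_sqrt_seq // ltn_subrL i_gt0.
Qed.

End FpsRing.

Arguments fpsX {F}.

(* The field of fractions of the ring of formal power series is the field of
   formal Laurent series; division by x takes place there. *)
Notation "f %:F" := (tofrac f) : ring_scope.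

(* Main.v *)
Require Import Defs.
From mathcomp Require Import all_boot all_order all_algebra all_fingroup.
From mathcomp Require Import boolp.
From mathcomp Require Import zify ring.
Import GRing.Theory.

(** A sortable permutation is recovered from its descent set [p] and from the
    descent set [q] of its flip: the flip is the layered word with descent set
    [q], and the permutation is obtained from it by reversing the blocks
    described by [p].  A pair [(p, q)] occurs exactly when [p] and [q] are
    disjoint and every element of [q] is next to an element of [p]; indeed
    across a peak or a valley a layered word rises, so that two consecutive
    reversed blocks meet in an ascent unless both are singletons forming a
    descent of the layered word.  Counting such pairs with a transfer matrix,
    [a] elements outside [p] and [e] elements in [p], yields the generating
    function [(1 + y z) / (1 - y - z - y z - 2 y^2 z)] in [y^a z^e].

    The series [D_k = sum_n b(n + k, n) x^n] and [E_k = sum_n b(n, n + k) x^n]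
    of its diagonals obey [D_(k+1) = (1 + 2x) D_k + x D_(k+1) + x D_(k+2)] and
    [E_(k+1) = E_k + x E_(k+1) + x (1 + 2x) E_(k+2)], linked at [k = 0].  This
    system has only one solution, and the closed forms solve it because
    [C = (1 - x - sqrt ((1 + x) (1 - 7x))) / (2x)] is a root of
    [x C^2 - (1 - x) C + (1 + 2x)].

    The series [W = sqrt ((1 + x) / (1 - 7x))] satisfies
    [(1 + x) (1 - 7x) W' = 4 W], and the resulting three-term recurrence is
    checked termwise, up to telescoping, on both binomial sums. *)

(** * Sortable words and pairs of descent sets *)

Fixpoint desc (w : seq nat) : seq bool :=
  if w is x :: w' then
    if w' is y :: _ then (y < x) :: desc w' else [::]
  else [::].

(* Splits [w] into blocks: flag [i] of [p] tells whether the letters of index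
   [i] and [i.+1] belong to the same block. *)
Fixpoint chunk (p : seq bool) (w : seq nat) : seq (seq nat) :=
  match w, p with
  | x :: w', b :: p' =>
      if b then (x :: head [::] (chunk p' w')) :: behead (chunk p' w')
      else [:: x] :: chunk p' w'
  | x :: _, [::] => [:: [:: x]]
  | [::], _ => [::]
  end.

(** Unlike in [flip], the blocks are prescribed by [p] and not read off from [w]; this is what makes
    the operation an involution. *)
Definition flipb (p : seq bool) (w : seq nat) : seq nat :=
  flatten [seq rev r | r <- chunk p w].

Lemma size_desc w : size (desc w) = (size w).-1.
Proof. by elim: w => [|x [|y w] IH] //=; rewrite IH. Qed.

Lemma chunk_cons p x w :
  exists r rs, chunk p (x :: w) = (x :: r) :: rs.
Proof. by case: p => [|[] p] /=; eauto. Qed.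

(** The size condition matters: once [p] is exhausted, [chunk] keeps a single further letter. *)
Lemma flatten_chunk p w : size w = (size p).+1 -> flatten (chunk p w) = w.
Proof.
elim: p w => [|b p IH] [|x w] //=; first by case: w.
move=> [sz]; have := IH w sz; case: w sz => // y w _.
by have [r [rs ->]] := chunk_cons p y w; case: b => /= ->.
Qed.

Lemma falls_chunk w : falls w = chunk (desc w) w.
Proof.
elim: w => // x [|y w] //= ->.
by have [r [rs /= ->]] := chunk_cons (desc (y :: w)) y w; case: ifP.
Qed.

Lemma flipE w : flip w = flipb (desc w) w.
Proof. by rewrite /flip falls_chunk. Qed.

Lemma chunk_nonempty p w : all (fun r => r != [::]) (chunk p w).
Proof.
elim: p w => [|b p IH] [|x w] //=; case: b => /=; last exact: IH.
by have := IH w; case: (chunk p w) => //= r rs /andP[].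
Qed.

Fixpoint block_sizes (p : seq bool) : seq nat :=
  if p is b :: p' then
    let r := block_sizes p' in
    if b then (head 0 r).+1 :: behead r else 1 :: r
  else [:: 1].

Lemma shape_chunk p w : size w = (size p).+1 -> shape (chunk p w) = block_sizes p.
Proof.
elim: p w => [|b p IH] [|x w] //= [sz]; have := IH w sz.
by case: (chunk p w) => [|r rs] /=; case: b => /= <-.
Qed.

Lemma perm_flatten_rev (ss : seq (seq nat)) :
  perm_eq (flatten [seq rev r | r <- ss]) (flatten ss).
Proof. by elim: ss => //= r ss IH; rewrite perm_cat // perm_rev. Qed.

Lemma perm_flipb p w : size w = (size p).+1 -> perm_eq (flipb p w) w.
Proof.
by move=> sz; rewrite -{2}(flatten_chunk p w sz) perm_flatten_rev.
Qed.

(** A list of blocks is determined by its flattening and its shape, and the shape depends on [p]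
    alone. *)
Lemma chunk_flipb p w : size w = (size p).+1 ->
  chunk p (flipb p w) = [seq rev r | r <- chunk p w].
Proof.
move=> sz; have sz' : size (flipb p w) = (size p).+1.
  by rewrite (perm_size (perm_flipb p w sz)).
apply: eq_from_flatten_shape; first by rewrite flatten_chunk.
rewrite shape_chunk // -(shape_chunk p w sz) /shape -map_comp.
by apply: eq_map => r /=; rewrite size_rev.
Qed.

Lemma flipbK p w : size w = (size p).+1 -> flipb p (flipb p w) = w.
Proof.
move=> sz; rewrite {1}/flipb chunk_flipb // -map_comp.
by rewrite (eq_map (g := id)) ?map_id ?flatten_chunk // => r /=; rewrite revK.
Qed.

Lemma desc_chunk p w : size w = (size p).+1 ->
  all (sorted gtn) (chunk p w) ->
  sorted (fun r1 r2 => last 0 r1 <= head 0 r2) (chunk p w) -> desc w = p.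
Proof.
elim: p w => [|b p IH] [|x [|y w]] //= [sz]; have := IH (y :: w).
have [r [rs ->]] := chunk_cons p y w; case: b => /= {}IH.
  move=> /andP[/andP[-> yr] rss] J; rewrite IH ?sz ?yr ?rss //.
  by move: J; case: (rs).
by move=> /andP[yr rss] /andP[/leq_gtF -> J]; rewrite IH ?sz ?yr ?rss.
Qed.

Lemma desc_falls p w : size w = (size p).+1 ->
  (desc w == p) = all (sorted gtn) (chunk p w) &&
    sorted (fun r1 r2 => last 0 r1 <= head 0 r2) (chunk p w).
Proof.
move=> sz; apply/eqP/andP => [<-|[H1 H2]]; last exact: desc_chunk.
by rewrite -falls_chunk falls_decreasing falls_maximal.
Qed.

(** The blocks of [flipb p w] are the reversed blocks of [w], so decreasing becomes increasing, and
    first and last letters are exchanged. *)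
Lemma desc_flipb p w : size w = (size p).+1 ->
  (desc (flipb p w) == p) = all (sorted ltn) (chunk p w) &&
    sorted (fun r1 r2 => head 0 r1 <= last 0 r2) (chunk p w).
Proof.
move=> sz; rewrite desc_falls ?(perm_size (perm_flipb _ _ sz)) //.
rewrite chunk_flipb // all_map sorted_map; congr andb.
  by apply: eq_all => r /=; rewrite rev_sorted.
apply: eq_sorted => r1 r2 /=.
by case/lastP: r2 => [|r2 y]; case: r1 => [|x r1];
  rewrite ?rev_rcons ?rev_cons ?last_rcons.
Qed.

Lemma desc_layers q w : size w = (size q).+1 ->
  all (sorted gtn) (chunk q w) -> sorted (allrel ltn) (chunk q w) -> desc w = q.
Proof.
move=> sz dec inc; apply: desc_chunk => //.
have := chunk_nonempty q w; move: inc; case: (chunk q w) => //= r rs.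
elim: rs r => //= r' rs IH r /andP[rr' inc] /and3P[r0 r'0 rs0].
rewrite IH ?r'0 // andbT; move/allrelP: rr'.
by case: r r0 => // a r _; case: r' r'0 {inc} => // b r' _ /(_ (last a r) b);
  rewrite mem_last mem_head => /(_ isT isT) /ltnW.
Qed.

Fixpoint rises_across_turns (w : seq nat) : bool :=
  if w is x :: w' then
    (if w' is y :: z :: _ then ((y < x) != (z < y)) ==> (x < z) else true)
      && rises_across_turns w'
  else true.

(** At a turn one step stays inside a layer and the other moves on to the next one, so the outer
    letters lie in consecutive layers. *)
Lemma rises_across_turns_layers q w : size w = (size q).+1 ->
  all (sorted gtn) (chunk q w) -> sorted (allrel ltn) (chunk q w) ->
  rises_across_turns w.
Proof.
elim: q w => [|b q IH] [|x w] //; first by case: w.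
case: w => // y w; case: q IH => [|d q] IH [sz].
  by case: w sz => //=; case: b.
case: w sz => // z w sz; have := IH (y :: z :: w).
have sz2 : (size w).+2 = (size q).+2 by move: sz => /= [->].
have -> : rises_across_turns [:: x, y, z & w] =
  (((y < x) != (z < y)) ==> (x < z)) && rises_across_turns [:: y, z & w] by [].
move: (rises_across_turns [:: y, z & w]) => {IH} P /=.
have [r [rs ->]] := chunk_cons q z w.
(* The flags tell whether [x, y] and [y, z] share a block. In the two mixed cases [x < z] comes from
   comparing consecutive layers. *)
case: b; case: d => /= IH.
- move=> /andP[/and3P[yx zy zr] rss] J; rewrite yx zy IH ?zy ?zr ?sz2 //.
  move: J; case: (rs) => //= ? ? /andP[+ ->].
  by rewrite !allrel_consl => /andP[_ ->].
- move=> /and3P[/andP[yx _] zr rss] /andP[].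
  rewrite !allrel_consl !allrel_consr /= => /and3P[/andP[xz xr] /andP[yz yr] _] J.
  by rewrite xz implybT IH ?zr ?sz2 // allrel_consl allrel_consr /= yz yr.
- move=> /andP[/andP[zy zr] rss] /andP[].
  rewrite !allrel_consl !allrel_consr /= => /andP[/and3P[xy xz xr] _] J.
  by rewrite xz implybT IH ?zy ?zr ?sz2.
- move=> /andP[zr rss] /and3P[].
  rewrite !allrel_consl !allrel_consr /=.
  move=> /andP[/andP[xy _] _] /andP[/andP[yz yr] _] J.
  rewrite (ltn_trans xy yz) implybT IH ?zr ?sz2 //.
  by rewrite allrel_consl allrel_consr /= yz yr J.
Qed.

Lemma sorted_chunk_layers q w : size w = (size q).+1 -> sorted ltn w ->
  all (sorted ltn) (chunk q w) /\ sorted (allrel ltn) (chunk q w).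
Proof.
move=> sz; rewrite -{1}(flatten_chunk q w sz) sorted_pairwise; last exact: ltn_trans.
elim: (chunk q w) => //= r rs IH.
rewrite pairwise_cat => /and3P[rrs pr /IH[Hs Ha]]; split.
  by rewrite sorted_pairwise ?pr //; exact: ltn_trans.
case: rs rrs {IH Hs} Ha => //= r' rs; rewrite allrel_catr => /andP[-> _] -> //.
Qed.

(** Reversing the blocks of an increasing word makes each block decreasing and leaves the order
    between blocks intact. *)
Lemma layered_iota q s (w := flipb q (iota s (size q).+1)) :
  [/\ desc w = q, rises_across_turns w & uniq w].
Proof.
have szi : size (iota s (size q).+1) = (size q).+1 by rewrite size_iota.
have [inc lay] := sorted_chunk_layers q _ szi (iota_ltn_sorted _ _).
have sz : size w = (size q).+1 by rewrite (perm_size (perm_flipb _ _ szi)).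
have dec : all (sorted gtn) (chunk q w).
  rewrite chunk_flipb // all_map; apply: sub_all inc => r /=.
  by rewrite rev_sorted.
have lay' : sorted (allrel ltn) (chunk q w).
  rewrite chunk_flipb // sorted_map; apply: sub_sorted lay => r1 r2 /=.
  by rewrite allrel_revl allrel_revr.
split; [exact: desc_layers|exact: rises_across_turns_layers dec lay'|].
by rewrite (perm_uniq (perm_flipb _ _ szi)) iota_uniq.
Qed.

(* [f] is the flag of [p] that precedes the first one. *)
Fixpoint admissible (f : bool) (p q : seq bool) : bool :=
  match p, q with
  | b :: p', d :: q' =>
      [&& ~~ (b && d), d ==> f || head false p' & admissible b p' q']
  | _, _ => true
  end.

Lemma last_chunk_ge p z w :
  all (sorted ltn) (chunk p (z :: w)) -> z <= last 0 (head [::] (chunk p (z :: w))).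
Proof.
have [r [rs ->]] := chunk_cons p z w => /= /andP[zr _].
case/lastP: r zr => // r y zr; rewrite last_rcons ltnW //.
have := order_path_min ltn_trans zr.
by rewrite all_rcons => /andP[].
Qed.

(* [h] stands for the first letter of the block of [y]; when [f] holds, this
   block started earlier and [x] is the letter before [y]. *)
Lemma admissible_chunk f h p x y w :
  size w = size p -> uniq (y :: w) -> rises_across_turns (y :: w) ->
  (if f then [&& h <= x, x < y & rises_across_turns [:: x, y & w]] else h == y) ->
  all (sorted ltn) (chunk p (y :: w)) &&
    path (fun r1 r2 => head 0 r1 <= last 0 r2) [:: h] (behead (chunk p (y :: w)))
  = admissible f p (desc (y :: w)).
Proof.
elim: p f h x y w => [|b p IH] f h x y [|z w] // [sz] uw kw Hf.
have lz := last_chunk_ge p z w.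
have {}IH f' h' x' := IH f' h' x' z w sz.
have hy : h <= y.
  by case: f Hf => [/and3P[hx /ltnW xy _]|/eqP-> //]; apply: leq_trans xy.
have [uz kz] : uniq (z :: w) /\ rises_across_turns (z :: w).
  by split; [case/andP: uw|case/andP: kw].
have zy : y < z = ~~ (z < y).
  rewrite -leqNgt ltn_neqAle; case: eqP => // yz.
  by move: uw; rewrite yz cons_uniq mem_head.
have -> : desc [:: y, z & w] = (z < y) :: desc (z :: w) by [].
move: (desc (z :: w)) IH => q IH; rewrite [admissible _ _ _]/=; case: b.
  (* [y] and [z] share a block, which can increase only if [z < y] fails; this is the disjointness
     of [p] and [q]. The first letter [h] is kept. *)
  have -> : chunk (true :: p) [:: y, z & w] = 
    (y :: head [::] (chunk p (z :: w))) :: behead (chunk p (z :: w)) by [].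
  move: (IH true h y); have [r [rs ->]] := chunk_cons p z w.
  rewrite /= => {}IH.
  by rewrite zy; have [//|zly] /= := boolP (z < y); rewrite IH ?hy ?zy ?zly.
(* The block of [y] ends here. It remains to compare [h] with the last letter of the block of
   [z]. *)
have -> : chunk (false :: p) [:: y, z & w] = [:: y] :: chunk p (z :: w) by [].
rewrite [behead _]/= andFb /=.
move: lz (IH false z z); rewrite eqxx => lz /(_ uz kz isT) => <-.
case: (boolP (all _ _)) lz => [H /(_ isT)|H _]; last first.
  by rewrite /= andbF.
(* If the block of [z] has a second letter [t], then [y > z < t] is a valley, so [y < t]. *)
have Hhd : head false p -> z < y -> y < last 0 (head [::] (chunk p (z :: w))).
  move: kw H; case: p w sz {IH uw Hf uz kz} => [|[] p] // [|t w] // [sz].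
  rewrite /= => /and3P[+ _ _].
  have := last_chunk_ge p t w; have [r [rs ->]] := chunk_cons p t w.
  rewrite /= => lt K /andP[/andP[zt tr] rss] _ zly.
  move: K; rewrite zly (leq_gtF (ltnW zt)) /= => /leq_trans; apply.
  by apply: lt; rewrite tr.
have Hno : ~~ head false p -> last 0 (head [::] (chunk p (z :: w))) = z.
  by case: (p) => [|[] p'].
move: H Hhd Hno; have [r [rs ->]] := chunk_cons p z w => H Hhd Hno lz.
rewrite [head _ _]/= in lz Hhd Hno *; rewrite [behead _]/= [path _ _ _]/=.
set J := fun _ _ : seq nat => _; set P := path J [:: z] rs.
(* [J] reads only the first letter of its left argument. *)
have -> : path J (z :: r) rs = P by rewrite /P; case: (rs).
rewrite /=; have [zly|zly] /= := boolP (z < y); last first.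
  by rewrite (leq_trans hy) // (leq_trans _ lz) // leqNgt.
(* If the block of [y] began earlier, [x < y > z] is a peak, and [h <= x < z]. *)
case: f Hf => [/and3P[hx xy /andP[+ _]]|/eqP->].
  rewrite (leq_gtF (ltnW xy)) zly /= => xz.
  by rewrite (leq_trans hx) // ltnW // (leq_trans xz).
(* Now [y] is alone in its block. If [z] is alone too, the blocks meet in the descent [y > z]; this
   is the one forbidden configuration. *)
case: (boolP (head false p)) Hhd Hno => [_ /(_ isT zly) /ltnW -> //|_ _ /(_ isT)] /=.
by move->; rewrite leqNgt zly.
Qed.

Lemma desc_flipb2 p q : size p = size q ->
  (desc (flipb p (flipb q (iota 0 (size q).+1))) == p) = admissible false p q.
Proof.
move=> szpq; have [dw kw uw] := layered_iota q 0.
have szi : size (iota 0 (size q).+1) = (size q).+1 by rewrite size_iota.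
move: (perm_size (perm_flipb _ _ szi)); rewrite szi.
move: (flipb q _) dw kw uw => [|y w] // dw kw uw [szw].
rewrite desc_flipb ?szpq /= ?szw //.
rewrite -dw -(admissible_chunk _ y _ 0) ?szw //=.
have [r [rs ->]] := chunk_cons p y w.
by congr andb; case: rs.
Qed.

Lemma size_ascents w : uniq w -> size (ascents w) = count negb (desc w).
Proof.
rewrite /ascents size_filter; elim: w => // x [|y w] // IH uw.
have xy : x != y by apply: contraTneq uw => ->; rewrite cons_uniq mem_head.
have := IH (subseq_uniq (subseq_cons _ _) uw); rewrite /= => <-.
rewrite -leqNgt ltn_neqAle xy -[1]/(1 + 0) iotaDl count_map.
by congr addn; apply: eq_count.
Qed.

(** * Enumeration of the admissible pairs *)

Fixpoint flags n : seq (seq bool * seq bool) :=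
  if n is m.+1 then
    [seq (x.1 :: pq.1, x.2 :: pq.2) |
      x <- [:: (true, false); (false, false); (false, true); (true, true)],
      pq <- flags m]
  else [:: ([::], [::])].

Lemma mem_flags n pq : (pq \in flags n) = (size pq.1 == n) && (size pq.2 == n).
Proof.
elim: n pq => [|n IH] [p q]; first by rewrite inE xpair_eqE; case: p; case: q.
apply/allpairsP/andP => /= [[[[b d] [p' q']] [_ + [-> ->]]]|].
  by rewrite IH /= => /andP[].
case: p q => [|b p] [|d q] //=; try by case.
move=> szs; exists ((b, d), (p, q)); split=> //=; first by case: b; case: d.
by rewrite IH; apply/andP.
Qed.

Lemma flags_uniq n : uniq (flags n).
Proof.
elim: n => // n IH; apply: allpairs_uniq => //.
by move=> [[b d] [p q]] [[b' d'] [p' q']] _ _ [-> -> -> ->].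
Qed.

Definition label_count f n k : nat :=
  count (fun pq => admissible f pq.1 pq.2 && (count negb pq.1 == k)) (flags n).

(** * Sortable permutations correspond to admissible pairs *)

Lemma word_uniq n (s : 'S_n) : uniq (word s).
Proof.
by rewrite map_inj_uniq ?enum_uniq // => i j /val_inj /perm_inj.
Qed.

Lemma perm_word n (s : 'S_n) : perm_eq (word s) (iota 0 n).
Proof.
apply: uniq_perm; rewrite ?word_uniq ?iota_uniq // => i.
rewrite mem_iota; apply/mapP/idP => [[j _ ->]|/= lt_in]; first exact: ltn_ord.
by exists ((s^-1)%g (Ordinal lt_in)); rewrite ?mem_enum // permKV.
Qed.

Lemma word_inj n : injective (@word n).
Proof.
move=> s t /eq_in_map st; apply/permP => i; apply: val_inj.
by apply: st; rewrite mem_enum.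
Qed.

Lemma wordP n w : perm_eq w (iota 0 n) -> exists s : 'S_n, w = word s.
Proof.
rewrite -(val_enum_ord n) => pw.
have sz : size w = n by rewrite (perm_size pw) size_map size_enum_ord.
have Hlt i : i < n -> nth 0 w i < n.
  move=> lt_in; have : nth 0 w i \in w by rewrite mem_nth ?sz.
  by rewrite (perm_mem pw) => /mapP[j _ ->]; exact: ltn_ord.
have inj : injective (fun i : 'I_n => Ordinal (Hlt i (ltn_ord i))).
  move=> i j [] /eqP; rewrite nth_uniq ?sz // => [/eqP/val_inj //|].
  by rewrite (perm_uniq pw) map_inj_uniq ?enum_uniq //; apply: val_inj.
exists (perm inj); apply: (@eq_from_nth _ 0).
   by rewrite size_map size_enum_ord.
move=> i; rewrite sz => lt_in; rewrite (nth_map (Ordinal lt_in)) ?size_enum_ord //.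
by rewrite permE /= nth_enum_ord.
Qed.

Lemma word1 n : word (1%g : 'S_n) = iota 0 n.
Proof. by rewrite -val_enum_ord; apply: eq_map => i; rewrite perm1. Qed.

(** Each flip is a [flipb] for the descent set of its argument, hence is undone by that same
    [flipb]. *)
Lemma flip2_iotaP n w : size w = n.+1 -> flip (flip w) = iota 0 n.+1 ->
  w = flipb (desc w) (flipb (desc (flip w)) (iota 0 n.+1)).
Proof.
move=> sz.
have sz1 : size w = (size (desc w)).+1 by rewrite size_desc sz.
have sz2 : size (flip w) = n.+1 by rewrite flipE (perm_size (perm_flipb _ _ sz1)).
rewrite [flip (flip w)]flipE => <-.
by rewrite flipbK ?size_desc ?sz2 // flipE flipbK.
Qed.

(** Sending a pair to [flipb p (flipb q id)] is a bijection from admissible pairs to sortable words;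
    the inverse takes the descent sets of the word and of its flip. *)
Lemma pop2_countE n k : pop2_count n.+1 k = label_count false n k.
Proof.
rewrite /pop2_count cardE /label_count -size_filter.
rewrite -(size_map (@word _)).
rewrite -[RHS](size_map (fun pq => flipb pq.1 (flipb pq.2 (iota 0 n.+1)))).
have szi : size (iota 0 n.+1) = n.+1 by rewrite size_iota.
have Hdesc pq : pq \in flags n -> admissible false pq.1 pq.2 ->
  let w := flipb pq.1 (flipb pq.2 (iota 0 n.+1)) in
  [/\ perm_eq w (iota 0 n.+1), desc w = pq.1, desc (flip w) = pq.2
     & flip (flip w) = iota 0 n.+1].
  case: pq => p q; rewrite mem_flags /= => /andP[/eqP szp /eqP szq] adm.
  have szi' : size (iota 0 n.+1) = (size q).+1 by rewrite szi szq.
  have p2 := perm_flipb q (iota 0 n.+1) szi'.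
  have sz2 : size (flipb q (iota 0 n.+1)) = (size p).+1.
    by rewrite (perm_size p2) szi szp.
  have p1 := perm_flipb p (flipb q (iota 0 n.+1)) sz2.
  have dp : desc (flipb p (flipb q (iota 0 n.+1))) = p.
    by apply/eqP; rewrite -{1}szq desc_flipb2 ?szq.
  have dq : desc (flipb q (iota 0 n.+1)) = q.
    by have [] := layered_iota q 0; rewrite szq.
  have fw : flip (flipb p (flipb q (iota 0 n.+1))) = flipb q (iota 0 n.+1).
    by rewrite flipE dp flipbK.
  by split; rewrite ?fw ?dp ?dq // ?(perm_trans p1) // flipE dq flipbK.
apply: perm_size; apply: uniq_perm.
- by rewrite map_inj_uniq ?enum_uniq //; apply: word_inj.
- rewrite map_inj_in_uniq ?filter_uniq ?flags_uniq // => pq pq'.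
  rewrite !mem_filter => /andP[/andP[a _] m] /andP[/andP[a' _] m'] E.
  have /= [_ d1 d2 _] := Hdesc _ m a; have /= [_ d1' d2' _] := Hdesc _ m' a'.
  rewrite -E in d1' d2'; case: pq pq' d1 d2 d1' d2' {E m a m' a'} => p q [p' q'] /=.
  by move=> -> -> -> ->.
move=> w; apply/mapP/mapP => [[s +] ->|[pq +] ->].
  rewrite mem_enum inE /pop2_sortable word1 => /andP[/eqP srt /eqP asc].
  have sz : size (word s) = n.+1 by rewrite (perm_size (perm_word _ s)) szi.
  have sz1 : size (word s) = (size (desc (word s))).+1 by rewrite size_desc sz.
  have szf : size (flip (word s)) = n.+1.
    by rewrite flipE (perm_size (perm_flipb _ _ sz1)).
  exists (desc (word s), desc (flip (word s))); last exact: flip2_iotaP.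
  rewrite mem_filter mem_flags !size_desc sz szf !eqxx andbT /=.
  rewrite -desc_flipb2 ?size_desc ?sz ?szf //= -(flip2_iotaP n) // eqxx /=.
  by rewrite -size_ascents ?word_uniq // asc eqxx.
rewrite mem_filter => /andP[/andP[adm cnt] pqn].
have [pw dw _ fw] := Hdesc _ pqn adm; have [s ws] := wordP n.+1 _ pw.
exists s => //; rewrite mem_enum inE /pop2_sortable word1 -ws fw eqxx /=.
by rewrite size_ascents ?dw // ws word_uniq.
Qed.

(** * Transfer recurrences *)

Lemma label_count0 f k : label_count f 0 k = (k == 0).
Proof. by rewrite /label_count /= addn0 eq_sym. Qed.

(* Completions of a flag of [q] whose left neighbour is not in [p]. *)
Definition pending_count n k : nat :=
  count (fun pq => [&& head false pq.1, admissible false pq.1 pq.2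
                     & count negb pq.1 == k]) (flags n).

Lemma count_flagsS (P : pred (seq bool * seq bool)) n :
  count P (flags n.+1) =
    count (fun pq => P (true :: pq.1, false :: pq.2)) (flags n) +
    (count (fun pq => P (false :: pq.1, false :: pq.2)) (flags n) +
    (count (fun pq => P (false :: pq.1, true :: pq.2)) (flags n) +
    count (fun pq => P (true :: pq.1, true :: pq.2)) (flags n))).
Proof. by rewrite /= !count_cat !count_map /= addn0. Qed.

(** Split on the first flags. The pair [(true, true)] is excluded; after [(false, true)] a neighbour
    in [p] is required, either [f] or the next flag. *)
Lemma label_countS f n k : label_count f n.+1 k =
  label_count true n k + (if k is j.+1 then label_count false n j +
    (if f then label_count false n j else pending_count n j) else 0).
Proof.
rewrite /label_count count_flagsS /=; congr addn.
rewrite [X in _ + (_ + X)]count_pred0 addn0; case: k => [|k].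
  by rewrite !(eq_count (a2 := pred0)) ?count_pred0 // => pq /=; rewrite andbF.
congr addn; case: f => /=; apply: eq_count => pq //=; by rewrite andbA.
Qed.

Lemma pending_countS n k : pending_count n.+1 k = label_count true n k.
Proof. by rewrite /pending_count count_flagsS /= !count_pred0 !addn0. Qed.

Lemma label_count_gt f n k : n < k -> label_count f n k = 0.
Proof.
move=> ltnk; rewrite /label_count (eq_in_count (a2 := pred0)) ?count_pred0 //.
move=> pq; rewrite mem_flags => /andP[/eqP szp _] /=.
have := count_size negb pq.1; rewrite szp => le_n.
by rewrite (ltn_eqF (leq_ltn_trans le_n ltnk)) andbF.
Qed.

(* [a] counts the flags outside [p], i.e. the ascents, and [e] those in [p]. *)
Definition ae_count f a e := label_count f (a + e) a.

Lemma ae_count0l f e : ae_count f 0 e = 1.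
Proof.
rewrite /ae_count add0n; elim: e f => [|e IH] f; first by rewrite label_count0.
by rewrite label_countS IH.
Qed.

Lemma pending_ae a e : pending_count (a + e) a =
  if e is e'.+1 then ae_count true a e' else 0.
Proof.
case: e => [|e]; last by rewrite addnS pending_countS.
by rewrite addn0; case: a => // a; rewrite pending_countS label_count_gt.
Qed.

Lemma ae_countS f a e : ae_count f a.+1 e =
  (if e is e'.+1 then ae_count true a.+1 e' else 0) + ae_count false a e +
  (if f then ae_count false a e else if e is e'.+1 then ae_count true a e' else 0).
Proof.
rewrite {1}/ae_count addSn label_countS pending_ae addnA; congr (_ + _ + _).
by case: e => [|e]; [rewrite addn0 label_count_gt|rewrite addnS -addSn].
Qed.

Lemma ae_count0r a : ae_count false a 0 = 1.
Proof. by elim: a => [|a IH]; rewrite ?ae_count0l // ae_countS IH. Qed.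

(** The correction at [e = 0] is the term [y z] of the numerator of the generating function. *)
Lemma ae_count_rec1 e : ae_count false 1 e.+1 =
  ae_count false 0 e.+1 + ae_count false 1 e + ae_count false 0 e + (e == 0).
Proof.
rewrite !(ae_countS false 0) !ae_count0l.
by case: e => [|e]; rewrite ?(ae_countS true) !ae_count0l //= !addn0; lia.
Qed.

(** Eliminating [ae_count true] leaves the recurrence with characteristic polynomial
    [1 - y - z - y z - 2 y^2 z]. *)
Lemma ae_count_rec a e : ae_count false a.+2 e.+1 =
  ae_count false a.+1 e.+1 + ae_count false a.+2 e + ae_count false a.+1 e
    + 2 * ae_count false a e.
Proof.
rewrite (ae_countS false a.+1) (ae_countS false a.+1 e).
by case: e => [|e]; rewrite !(ae_countS true) ?ae_count0r //; lia.
Qed.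

Local Open Scope ring_scope.

(** * Series of the diagonals *)

(** The recurrence read along diagonals, with [x = y z]; the numerator becomes [1 + fpsX] on the
    central one. Doubling is written as a sum so that [coefsD] and [coefsXM] suffice to extract
    coefficients. *)
Definition diagonal_system (F : fieldType) (D E : nat -> fps F) : Prop :=
  [/\ D 0 = E 0,
      D 0 = 1 + fpsX + fpsX * (D 0 + D 1 + E 1 + fpsX * (E 1 + E 1)),
      forall k, D k.+1 = D k + fpsX * (D k + D k + D k.+1 + D k.+2)
    & forall k, E k.+1 = E k + fpsX * (E k.+1 + E k.+2 + fpsX * (E k.+2 + E k.+2))].

(** The [n]-th coefficients depend on lower ones and on the [n]-th coefficient of the preceding
    diagonal: induction on [n], then on [k]. *)
Lemma diagonal_system_unique (F : fieldType) (D E D' E' : nat -> fps F) :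
  diagonal_system F D E -> diagonal_system F D' E' -> D =1 D' /\ E =1 E'.
Proof.
move=> [DE D0 DS ES] [DE' D0' DS' ES'].
suff H n k : coefs (D k) n = coefs (D' k) n /\ coefs (E k) n = coefs (E' k) n.
  by split=> k; apply: fpsP => n; case: (H n k).
elim/ltn_ind: n k => n IH.
have HX f g : (forall m, (m < n)%N -> coefs f m = coefs g m) ->
    forall m, (m <= n)%N -> coefs (fpsX * f) m = coefs (fpsX * g) m.
  by move=> fg [|m] ltmn; rewrite !coefsXM // fg.
have HE2 j m : (m < n)%N ->
    coefs (fpsX * (E j + E j)) m = coefs (fpsX * (E' j + E' j)) m.
  move=> ltmn; apply: HX (ltnW ltmn) => i lti.
  by rewrite !coefsD !(proj2 (IH _ lti _)).
have H0 : coefs (D 0) n = coefs (D' 0) n.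
  rewrite D0 D0' [LHS]coefsD [RHS]coefsD; congr (_ + _).
  apply: (HX) => // m ltmn; rewrite coefsD [RHS]coefsD HE2 //.
  by rewrite !coefsD !(proj1 (IH m ltmn _)) !(proj2 (IH m ltmn _)).
elim=> [|k [IHD IHE]]; first by rewrite -DE -DE'.
split.
  rewrite DS DS' [LHS]coefsD [RHS]coefsD IHD; congr (_ + _).
  by apply: (HX) => // m ltmn; rewrite !coefsD !(proj1 (IH m ltmn _)).
rewrite ES ES' [LHS]coefsD [RHS]coefsD IHE; congr (_ + _).
apply: (HX) => // m ltmn; rewrite coefsD [RHS]coefsD HE2 //.
by rewrite !coefsD !(proj2 (IH m ltmn _)).
Qed.

Definition diag_above k : fps rat := Fps (fun n => (ae_count false (n + k) n)%:R).
Definition diag_below k : fps rat := Fps (fun n => (ae_count false n (n + k))%:R).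

Lemma diagonal_system_count : diagonal_system rat diag_above diag_below.
Proof.
split=> [|||].
- by apply: fpsP => n /=; rewrite addn0.
- apply: fpsP => -[|[|n]]; rewrite !(coefsD, coefsXM) coefs1 /= ?addr0 ?add0r.
  + by rewrite ae_count0l.
  + rewrite ?(addn0, addn1, add0n) ae_count_rec1 !ae_count0l !ae_count0r.
    by rewrite eqxx !natrD /=; ring.
  + by rewrite ?(addn0, addn1) ae_count_rec mul2n -addnn !natrD; ring.
- move=> k; apply: fpsP => -[|n]; rewrite !(coefsD, coefsXM) /= ?addr0.
    by rewrite !ae_count0r.
  by rewrite addSnnS !addnS addSn ae_count_rec mul2n -addnn !natrD; ring.
move=> k; apply: fpsP => -[|[|n]]; rewrite !(coefsD, coefsXM) /= ?addr0.
- by rewrite !ae_count0l.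
- by rewrite ?add0n !add1n ae_count_rec1 !ae_count0l addn0 !natrD; ring.
by rewrite !addnS !addSn ae_count_rec mul2n -addnn !natrD; ring.
Qed.

(** * Closed forms of the diagonals *)

Lemma nat_fps n : n%:R = Fps (fun i => if i == 0 then n%:R else 0) :> fps rat.
Proof.
elim: n => [|n IH]; apply: fpsP => i; first by rewrite coefs0 /= if_same.
by rewrite -natr1 coefsD IH coefs1 /=; case: eqP => _; rewrite ?natr1 ?addr0.
Qed.

Lemma coefs_nat0 n : coefs (n%:R : fps rat) 0 = n%:R.
Proof. by rewrite nat_fps. Qed.

Lemma coefsM0 (f g : fps rat) : coefs (f * g) 0 = coefs f 0 * coefs g 0.
Proof. by rewrite coefsM big_ord1. Qed.

Lemma fps_unitE (f : fps rat) : (f \is a GRing.unit) = (coefs f 0 != 0).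
Proof. by []. Qed.

(** The alternative [f = - g] is excluded by the constant terms. *)
Lemma fps_eq_sqr (f g : fps rat) :
  f ^+ 2 = g ^+ 2 -> coefs f 0 = 1 -> coefs g 0 = 1 -> f = g.
Proof.
move=> /eqP; rewrite -subr_eq0 subr_sqr mulf_eq0 subr_eq0 => /orP[/eqP //|].
move=> /eqP /(congr1 (fun h => coefs h 0)); rewrite coefsD coefs0 => + f0 g0.
by rewrite f0 g0.
Qed.

Definition sqrt_ratio : fps rat := fps_sqrt ((1 + fpsX) / (1 - 7 * fpsX)).
Definition sqrt_prod : fps rat := fps_sqrt ((1 + fpsX) * (1 - 7 * fpsX)).

(** Division by [2 * fpsX] carried out as a shift, which loses nothing because the constant term
    vanishes. *)
Definition quad_root : fps rat :=
  Fps (fun n => coefs (1 - fpsX - sqrt_prod) n.+1 / 2).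

Lemma coefs_1DX0 : coefs (1 + fpsX : fps rat) 0 = 1.
Proof. by rewrite coefsD /= addr0. Qed.

Lemma coefs_1B7X0 : coefs (1 - 7 * fpsX : fps rat) 0 = 1.
Proof. by rewrite coefsD coefsN coefsM0 mulr0 subr0. Qed.

Lemma sqrt_prodK : sqrt_prod ^+ 2 = (1 + fpsX) * (1 - 7 * fpsX).
Proof. by rewrite fps_sqrtK // coefsM0 coefs_1DX0 coefs_1B7X0 mulr1. Qed.

Lemma sqrt_ratioK : sqrt_ratio ^+ 2 * (1 - 7 * fpsX) = 1 + fpsX.
Proof.
have u : (1 - 7 * fpsX : fps rat) \is a GRing.unit.
  by rewrite fps_unitE coefs_1B7X0.
have i0 : coefs ((1 - 7 * fpsX)^-1 : fps rat) 0 = 1.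
  have := congr1 (fun h => coefs h 0) (mulrV u).
  by rewrite coefsM0 coefs_1B7X0 mul1r coefs1.
by rewrite fps_sqrtK ?divrK // coefsM0 i0 coefs_1DX0 mulr1.
Qed.

Lemma sqrt_ratio_prod : sqrt_ratio * sqrt_prod = 1 + fpsX.
Proof.
apply: fps_eq_sqr; [|by rewrite coefsM0 !fps_sqrt0 mulr1|exact: coefs_1DX0].
by rewrite exprMn sqrt_prodK mulrCA sqrt_ratioK expr2.
Qed.

Lemma quad_rootE : 2 * fpsX * quad_root = 1 - fpsX - sqrt_prod.
Proof.
have -> : 1 - fpsX - sqrt_prod = fpsX * (quad_root + quad_root); last by ring.
apply: fpsP => -[|n]; rewrite coefsXM ?[coefs (_ + quad_root) _]coefsD.
  by rewrite !coefsD !coefsN coefs1 /= subr0 subrr.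
have -> : coefs quad_root n = coefs (1 - fpsX - sqrt_prod) n.+1 / 2 by [].
by field.
Qed.

Lemma fpsX_neq0 : fpsX != 0 :> fps rat.
Proof. by apply/eqP => /(congr1 (fun h => coefs h 1)). Qed.

Lemma natS_neq0 n : n.+1%:R != 0 :> fps rat.
Proof.
apply/eqP => /(congr1 (fun h => coefs h 0)); rewrite coefs_nat0 coefs0 => /eqP.
by rewrite Num.Theory.pnatr_eq0.
Qed.

(** Square [sqrt_prod = 1 - x - 2 x C] and cancel [4 x]. *)
Lemma quad_root_eq :
  quad_root = 1 + 2 * fpsX + fpsX * (quad_root + quad_root ^+ 2).
Proof.
have nz : 4 * fpsX != 0 :> fps rat by rewrite mulf_neq0 ?fpsX_neq0 ?natS_neq0.
apply: (mulfI nz); have /eqP := sqrt_prodK.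
have -> : sqrt_prod = 1 - fpsX - 2 * fpsX * quad_root by rewrite quad_rootE; ring.
rewrite -subr_eq0 => /eqP H; apply/esym/eqP; rewrite -subr_eq0 -H; apply/eqP.
by ring.
Qed.

Definition one2X : fps rat := 1 + 2 * fpsX.

Lemma one2X_unit : one2X \is a GRing.unit.
Proof. by rewrite fps_unitE coefsD coefsM0 mulr0 addr0. Qed.

Lemma diagonal_system_closed : diagonal_system rat
  (fun k => sqrt_ratio * quad_root ^+ k)
  (fun k => sqrt_ratio * (quad_root / one2X) ^+ k).
Proof.
set W := sqrt_ratio; set C := quad_root; set C' := C / one2X.
have CC' : C = C' * (1 + 2 * fpsX) by rewrite divrK ?one2X_unit.
have eqC : C = 1 + 2 * fpsX + fpsX * (C + C ^+ 2) := quad_root_eq.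
have WR : W * (1 - fpsX - 2 * fpsX * C) = 1 + fpsX.
  by rewrite -sqrt_ratio_prod -/W quad_rootE; ring.
split=> [||k|k].
- by rewrite !expr0.
- rewrite !expr0 !expr1 -WR.
  have -> : W * 1 + W * C + W * C' + fpsX * (W * C' + W * C') =
    W * (1 + C + C' * (1 + 2 * fpsX)) by ring.
  by rewrite -CC'; ring.
- have -> : W * C ^+ k +
      fpsX * (W * C ^+ k + W * C ^+ k + W * C ^+ k.+1 + W * C ^+ k.+2) =
      W * C ^+ k * (1 + 2 * fpsX + fpsX * (C + C ^+ 2)) by rewrite !exprS; ring.
  by rewrite -eqC exprSr mulrA.
(* Multiplying by [1 + 2 x] and using [C = (1 + 2 x) C'] turns the last clause into the equation of
   [C]. *)
apply: (mulIr one2X_unit); rewrite /one2X.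
have -> : (W * C' ^+ k + fpsX * (W * C' ^+ k.+1 + W * C' ^+ k.+2 +
    fpsX * (W * C' ^+ k.+2 + W * C' ^+ k.+2))) * (1 + 2 * fpsX)
  = W * C' ^+ k * (1 + 2 * fpsX + fpsX * (C' * (1 + 2 * fpsX) +
     (C' * (1 + 2 * fpsX)) ^+ 2)) by rewrite !exprS; ring.
by rewrite -CC' -eqC CC' exprSr; ring.
Qed.

Lemma diag_aboveE k : diag_above k = sqrt_ratio * quad_root ^+ k.
Proof.
by case: (diagonal_system_unique _ _ _ _ _ diagonal_system_count
  diagonal_system_closed).
Qed.

Lemma diag_belowE k : diag_below k = sqrt_ratio * (quad_root / one2X) ^+ k.
Proof.
by case: (diagonal_system_unique _ _ _ _ _ diagonal_system_count
  diagonal_system_closed).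
Qed.

Lemma pop2_count_above n k :
  pop2_count (2 * n + k + 1) (n + k) = ae_count false (n + k) n.
Proof. by rewrite addn1 pop2_countE /ae_count; congr label_count; lia. Qed.

Lemma pop2_count_below n k :
  pop2_count (2 * n + k + 1) n = ae_count false n (n + k).
Proof. by rewrite addn1 pop2_countE /ae_count; congr label_count; lia. Qed.

(** Brings both quotients of the theorem back to power series, with [f] equal to [1] or to
    [1 + 2 * fpsX]. *)
Lemma tofrac_quad_root (f : fps rat) : f \is a GRing.unit ->
  (1 - fpsX - sqrt_prod)%:F / (2 * fpsX * f)%:F = (quad_root / f)%:F.
Proof.
move=> uf; rewrite -quad_rootE.
have nz : (2 * fpsX * f)%:F != 0 :> {fraction fps rat}.
  rewrite tofrac_eq0 !mulf_neq0 ?fpsX_neq0 ?natS_neq0 //.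
  by apply: contraTneq uf => ->; rewrite unitr0.
apply: (mulIf nz); rewrite divfK // -tofracM; congr tofrac.
by rewrite -[LHS]mul1r -(divrr uf); ring.
Qed.

(** * Binomial formulas for the central diagonal *)

Definition fps_deriv (f : fps rat) : fps rat :=
  Fps (fun n => n.+1%:R * coefs f n.+1).

Lemma fps_derivM f g :
  fps_deriv (f * g) = fps_deriv f * g + f * fps_deriv g.
Proof.
apply: fpsP => n; rewrite coefsD [LHS]/= -/(coefs (f * g) n.+1).
rewrite !coefsM /=.
(* Distribute [n + 1 = i + (n + 1 - i)]; one boundary term of each sum vanishes. *)
transitivity (\sum_(i < n.+2) i%:R * coefs f i * coefs g (n.+1 - i) +
    \sum_(i < n.+2) coefs f i * ((n.+1 - i)%:R * coefs g (n.+1 - i))).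
  rewrite mulr_sumr -big_split; apply: eq_bigr => i _ /=.
  by rewrite natrB; [ring|rewrite -ltnS].
rewrite big_ord_recl /= !mul0r add0r; congr (_ + _).
rewrite big_ord_recr /= subnn mul0r mulr0 addr0; apply: eq_bigr => i _.
by rewrite subSn // -ltnS.
Qed.

Lemma coefsX_deriv f n : coefs (fpsX * fps_deriv f) n = n%:R * coefs f n.
Proof. by rewrite coefsXM; case: n => [|n] //=; rewrite mul0r. Qed.

Lemma fps_derivX : fps_deriv (1 + fpsX) = 1.
Proof.
by apply: fpsP => -[|n]; rewrite /= ?add0r ?mulr1 ?addr0 ?mulr0.
Qed.

Lemma fps_deriv_1B7X : fps_deriv (1 - 7 * fpsX) = - 7.
Proof.
have -> : 1 - 7 * fpsX = 8 - 7 * (1 + fpsX) :> fps rat by ring.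
have der_nat m : fps_deriv m%:R = 0.
  by apply: fpsP => n; rewrite /= nat_fps /= mulr0.
have derB f g : fps_deriv (f - g) = fps_deriv f - fps_deriv g.
  by apply: fpsP => n; rewrite /= mulrBr.
by rewrite derB fps_derivM !der_nat fps_derivX; ring.
Qed.

(** Differentiate [W^2 (1 - 7x) = 1 + x], multiply by [1 + x], and cancel [2 W]. *)
Lemma sqrt_ratio_ode :
  (1 + fpsX) * (1 - 7 * fpsX) * fps_deriv sqrt_ratio = 4 * sqrt_ratio.
Proof.
set W := sqrt_ratio; set W' := fps_deriv W.
have W0 : W != 0 by apply/eqP => /(congr1 (fun h => coefs h 0)).
have nz : 2 * W != 0 by rewrite mulf_neq0 ?natS_neq0.
have K : W ^+ 2 * (1 - 7 * fpsX) = 1 + fpsX := sqrt_ratioK.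
have H : 2 * W * W' * (1 - 7 * fpsX) = 1 + 7 * W ^+ 2.
  have := congr1 fps_deriv K; rewrite fps_derivX expr2 !fps_derivM.
  rewrite fps_deriv_1B7X -/W' => /eqP; rewrite -subr_eq0 => /eqP E.
  by apply/eqP; rewrite -subr_eq0 -E; apply/eqP; ring.
apply: (mulfI nz).
have -> : 2 * W * ((1 + fpsX) * (1 - 7 * fpsX) * W') =
  (1 + fpsX) * (2 * W * W' * (1 - 7 * fpsX)) by ring.
rewrite H mulrDr mulr1 -{1}K.
by ring.
Qed.

Lemma sqrt_ratio_rec n : n.+2%:R * coefs sqrt_ratio n.+2 =
  (6 * n%:R + 10) * coefs sqrt_ratio n.+1 + 7 * n%:R * coefs sqrt_ratio n.
Proof.
set W := sqrt_ratio; set D := fps_deriv W.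
have E : D = (W + W + W + W) + fpsX * (D + D + D + D + D + D) +
  fpsX * (fpsX * (D + D + D + D + D + D + D)).
  have /eqP := sqrt_ratio_ode; rewrite -/W -/D -subr_eq0 => /eqP H.
  by apply/eqP; rewrite -subr_eq0 -H; apply/eqP; ring.
have xD m : coefs (fpsX * (D + D + D + D + D + D + D)) m = 7 * m%:R * coefs W m.
  by rewrite !mulrDr !coefsD !coefsX_deriv; ring.
have -> : n.+2%:R * coefs W n.+2 = coefs D n.+1 by [].
rewrite E !coefsD coefsXM [coefs (fpsX * (fpsX * _)) _]coefsXM xD !coefsD.
have -> : coefs D n = n.+1%:R * coefs W n.+1 by [].
by rewrite -natr1; ring.
Qed.

Lemma sqrt_ratio1 : coefs sqrt_ratio 1 = 4.
Proof.
have /(congr1 (fun h => coefs h 0)) := sqrt_ratio_ode.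
rewrite coefsM0 [coefs (4 * _) _]coefsM0 coefs_nat0 fps_sqrt0 coefsM0.
by rewrite coefs_1DX0 coefs_1B7X0 /= !mul1r mulr1.
Qed.

Lemma ode_rec_unique (u v : nat -> rat) :
  (forall n, n.+2%:R * u n.+2 = (6 * n%:R + 10) * u n.+1 + 7 * n%:R * u n) ->
  (forall n, n.+2%:R * v n.+2 = (6 * n%:R + 10) * v n.+1 + 7 * n%:R * v n) ->
  u 0 = v 0 -> u 1 = v 1 -> u =1 v.
Proof.
move=> ru rv e0 e1 n.
suff [] : u n = v n /\ u n.+1 = v n.+1 by [].
elim: n => // n [IH0 IH1]; split=> //.
have nz : n.+2%:R != 0 :> rat by rewrite Num.Theory.pnatr_eq0.
by apply: (mulfI nz); rewrite ru rv IH0 IH1.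
Qed.

(** * The recurrence checked on both binomial sums *)

Lemma mul_bin_down_rat n j :
  n.+1%:R * 'C(n, j)%:R = (n.+1%:R - j%:R) * 'C(n.+1, j)%:R :> rat.
Proof.
have [lejn|ltnj] := leqP j n.+1.
  by rewrite -natrB // -!natrM (mul_bin_down n.+1).
by rewrite !bin_small ?mulr0 // ltnW.
Qed.

Lemma mul_bin_diag_rat n j :
  j.+1%:R * 'C(n.+1, j.+1)%:R = n.+1%:R * 'C(n, j)%:R :> rat.
Proof. by rewrite -!natrM -(mul_bin_diag n.+1). Qed.

Lemma central_bin_rec j :
  j.+1%:R * 'C(2 * j.+1, j.+1)%:R = 2 * (2 * j%:R + 1) * 'C(2 * j, j)%:R :> rat.
Proof.
have nz : j.+1%:R != 0 :> rat by rewrite Num.Theory.pnatr_eq0.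
apply: (mulfI nz); have -> : (2 * j.+1)%N = (2 * j).+2 by lia.
rewrite mul_bin_diag_rat; have := mul_bin_down_rat (2 * j) j.
rewrite -!natr1 natrM => H.
have -> : 2 * (2 * j%:R + 1) * 'C(2 * j, j)%:R =
  2 * ((2 * j%:R + 1) * 'C(2 * j, j)%:R) :> rat by ring.
by rewrite H; ring.
Qed.

(** The coefficient of [t^j] in [(t - 1)^m]; the exponent [m + j] has the parity of [m - j] without
    truncated subtraction. *)
Definition alt_bin m j : rat := (-1) ^+ (m + j) * 'C(m, j)%:R.

Lemma alt_bin_small m j : (m < j)%N -> alt_bin m j = 0.
Proof. by move=> ltmj; rewrite /alt_bin bin_small ?mulr0. Qed.

(** Trades the recurrence in [m] for a shift in [j] at the single level [m + 1], ready for summation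
    by parts. *)
Lemma alt_bin_rec m j :
  m.+3%:R * alt_bin m.+2 j - 6 * m.+2%:R * alt_bin m.+1 j
    - 7 * m.+1%:R * alt_bin m j =
  j.+1%:R * ((if j is i.+1 then alt_bin m.+1 i else 0) - 8 * alt_bin m.+1 j).
Proof.
have H1 : m.+1%:R * alt_bin m j = - (m.+1%:R - j%:R) * alt_bin m.+1 j.
  by rewrite /alt_bin mulrCA mul_bin_down_rat addSn exprS; ring.
have -> : 7 * m.+1%:R * alt_bin m j = 7 * (m.+1%:R * alt_bin m j) by ring.
rewrite H1; case: j {H1} => [|j].
  by rewrite /alt_bin !bin0 !addn0 !exprS -!natr1; ring.
have H2 : (m.+1%:R - j%:R) * alt_bin m.+1 j + j.+1%:R * alt_bin m.+1 j.+1 = 0.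
  rewrite /alt_bin [X in X + _]mulrCA -mul_bin_down_rat.
  by rewrite [X in _ + X]mulrCA mul_bin_diag_rat addnS exprS; ring.
have -> : alt_bin m.+2 j.+1 = alt_bin m.+1 j - alt_bin m.+1 j.+1.
  by rewrite /alt_bin binS natrD !addnS !addSn !exprS; ring.
apply/eqP; rewrite -subr_eq0 -H2 -!natr1; apply/eqP; ring.
Qed.

Definition alt_sum m : rat :=
  \sum_(j < m.+1) 2 ^+ j.+1 * 'C(2 * j.+1, j.+1)%:R * alt_bin m j.

Lemma sum_ord_widen (F : nat -> rat) m N : (m <= N)%N ->
  (forall j, (m <= j)%N -> F j = 0) -> \sum_(j < m) F j = \sum_(j < N) F j.
Proof.
move=> lemN F0; rewrite (big_ord_widen _ _ lemN).
rewrite [RHS](bigID (fun j : 'I_N => (j < m)%N)).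
by rewrite /= [X in _ + X]big1 ?addr0 // => j; rewrite -leqNgt => /F0.
Qed.

(** Lets the sums at three consecutive indices share one range. *)
Lemma alt_sumE m N : (m < N)%N ->
  alt_sum m = \sum_(j < N) 2 ^+ j.+1 * 'C(2 * j.+1, j.+1)%:R * alt_bin m j.
Proof.
pose t j := 2 ^+ j.+1 * 'C(2 * j.+1, j.+1)%:R * alt_bin m j.
move=> ltmN; apply: (sum_ord_widen t _ _ ltmN).
by move=> j /alt_bin_small t0; rewrite /t t0 mulr0.
Qed.

Lemma alt_sum_rec m : m.+3%:R * alt_sum m.+2 =
  (6 * m.+1%:R + 10) * alt_sum m.+1 + 7 * m.+1%:R * alt_sum m.
Proof.
set c := fun j : nat => 2 ^+ j.+1 * 'C(2 * j.+1, j.+1)%:R : rat.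
have sE i : (i <= m.+2)%N -> alt_sum i = \sum_(j < m.+3) c j * alt_bin i j.
  by move=> lei; rewrite (alt_sumE _ m.+3).
(* Since [6 (m + 1) + 10 = 6 (m + 2) + 4], the shift in [j] has to leave exactly
   [4 * alt_sum m.+1]. *)
suff: m.+3%:R * alt_sum m.+2 - 6 * m.+2%:R * alt_sum m.+1
    - 7 * m.+1%:R * alt_sum m = 4 * alt_sum m.+1.
  by move=> H; apply/eqP; rewrite -subr_eq0; apply/eqP;
    rewrite -[RHS](subrr (4 * alt_sum m.+1)) -{1}H -!natr1; ring.
rewrite !sE // 1?ltnW // !mulr_sumr -!sumrB.
pose prev j := if j is i.+1 then alt_bin m.+1 i else 0.
transitivity (\sum_(j < m.+3) c j * (j.+1%:R * (prev j - 8 * alt_bin m.+1 j))).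
  by apply: eq_bigr => j _; rewrite -alt_bin_rec; ring.
transitivity (\sum_(j < m.+3) c j * j.+1%:R * prev j
   - \sum_(j < m.+3) 8 * j.+1%:R * c j * alt_bin m.+1 j).
  by rewrite -sumrB; apply: eq_bigr => j _; move: (prev j) (c j) => ? ?; ring.
rewrite big_ord_recl /= mulr0 add0r.
have -> : \sum_(j < m.+2) c (bump 0 j) * (bump 0 j).+1%:R * alt_bin m.+1 j =
   \sum_(j < m.+3) c j.+1 * j.+2%:R * alt_bin m.+1 j.
  by rewrite [RHS]big_ord_recr /= [alt_bin _ m.+2]alt_bin_small // mulr0 addr0.
rewrite -sumrB; apply: eq_bigr => j _.
(* Subtracting [8 (j + 1) c j] from this leaves [4 c j]. *)
have -> : c j.+1 * j.+2%:R = (8 * j%:R + 12) * c j.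
  rewrite /c exprS; have := central_bin_rec j.+1; rewrite -natr1 => H.
  rewrite -mulrA [X in _ * X]mulrC H; ring.
by rewrite -natr1; ring.
Qed.

Lemma sqrt_ratio_alt_sum m : coefs sqrt_ratio m.+1 = alt_sum m.
Proof.
pose v n := if n is m.+1 then alt_sum m else 1.
apply: (ode_rec_unique (coefs sqrt_ratio) v sqrt_ratio_rec _ _ _ m.+1) => //.
- case=> [|n]; last exact: alt_sum_rec.
  by rewrite /v /alt_sum !big_ord_recr !big_ord0 /alt_bin; apply/eqP; vm_compute.
- rewrite sqrt_ratio1 /v /alt_sum /= big_ord_recr big_ord0 /alt_bin.
  by apply/eqP; vm_compute.
Qed.

Lemma alt_sum_rev m : alt_sum m =
  \sum_(0 <= i < m.+1) (-1) ^+ i * 2 ^+ (m.+1 - i)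
     * ('C(2 * (m.+1 - i), m.+1 - i))%:R * ('C(m.+1 - 1, i))%:R.
Proof.
rewrite big_mkord [RHS](reindex_inj rev_ord_inj) /=; apply: eq_bigr => j _.
have lejm : (j <= m)%N by rewrite -ltnS.
rewrite subSS subSn ?leq_subr // subKn // subn1 /= bin_sub // /alt_bin.
rewrite -signr_odd oddD -oddB // signr_odd; ring.
Qed.

(** The coefficient of [t^m] in [(3 + t)^n]; the quotient avoids a truncated [n - m]. *)
Definition ternary_bin n m : rat := 'C(n, m)%:R * 3 ^+ n / 3 ^+ m.

Lemma ternary_bin_rec0 n :
  n.+2%:R * ternary_bin n.+2 0 - (6 * n%:R + 9) * ternary_bin n.+1 0
    - 7 * n.+1%:R * ternary_bin n 0 = - 16 * ternary_bin n.+1 1.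
Proof.
by rewrite /ternary_bin !bin0 bin1 !exprS expr0 -!natr1; field.
Qed.

Lemma ternary_bin_recS n m :
  n.+2%:R * ternary_bin n.+2 m.+1 - (6 * n%:R + 9) * ternary_bin n.+1 m.+1
    - 7 * n.+1%:R * ternary_bin n m.+1 =
  m.+1%:R * ternary_bin n.+1 m - 16 * m.+2%:R * ternary_bin n.+1 m.+2.
Proof.
have nz : 3 ^+ m != 0 :> rat by rewrite expf_neq0.
have H1 := mul_bin_diag_rat n m.+1.
have H2 := mul_bin_down_rat n m.
have -> : 16 * m.+2%:R * ternary_bin n.+1 m.+2 =
   16 * (m.+2%:R * 'C(n.+1, m.+2)%:R) * 3 ^+ n.+1 / 3 ^+ m.+2.
  by rewrite /ternary_bin; ring.
rewrite H1 /ternary_bin (binS n.+1 m) natrD.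
have Pas : 'C(n.+1, m.+1)%:R = 'C(n, m.+1)%:R + 'C(n, m)%:R :> rat.
  by rewrite binS natrD.
have -> : m.+1%:R * ('C(n.+1, m)%:R * 3 ^+ n.+1 / 3 ^+ m) =
   (n.+2%:R * 'C(n.+1, m)%:R - n.+1%:R * 'C(n, m)%:R) * 3 ^+ n.+1 / 3 ^+ m :> rat.
  by rewrite H2 -!natr1; ring.
by rewrite Pas !exprS -!natr1; field.
Qed.

(** The coefficient of [t^n] in [(2 + 3 t + 2 t^2)^n]. *)
Definition central_trinomial n : rat :=
  \sum_(k < n.+1) 'C(2 * k, k)%:R * 4 ^+ k * ternary_bin n (2 * k).

Lemma central_trinomialE n N : (n < N)%N -> central_trinomial n =
  \sum_(k < N) 'C(2 * k, k)%:R * 4 ^+ k * ternary_bin n (2 * k).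
Proof.
move=> ltnN.
apply: (sum_ord_widen (fun k => 'C(2 * k, k)%:R * 4 ^+ k * ternary_bin n (2 * k))
  _ _ ltnN) => k ltnk.
by rewrite /ternary_bin [X in X%:R * 3 ^+ _]bin_small ?mul0r ?mulr0 //; lia.
Qed.

Lemma central_trinomial_rec n : n.+2%:R * central_trinomial n.+2 =
  (6 * n%:R + 9) * central_trinomial n.+1 + 7 * n.+1%:R * central_trinomial n.
Proof.
pose g k : rat := 'C(2 * k, k)%:R * 4 ^+ k.
have hE i : (i <= n.+2)%N ->
    central_trinomial i = \sum_(k < n.+3) g k * ternary_bin i (2 * k).
  by move=> lei; rewrite (central_trinomialE _ n.+3).
apply/eqP; rewrite -subr_eq0 opprD addrA; apply/eqP.
rewrite !hE // 1?ltnW // !mulr_sumr -!sumrB.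
pose prev k : rat :=
  if k is j.+1 then (2 * k)%:R * ternary_bin n.+1 (2 * j).+1 else 0.
transitivity (\sum_(k < n.+3) g k * prev k -
    \sum_(k < n.+3) 16 * (2 * k).+1%:R * g k * ternary_bin n.+1 (2 * k).+1).
  rewrite -sumrB; apply: eq_bigr => k _.
  transitivity (g k * (n.+2%:R * ternary_bin n.+2 (2 * k) -
    (6 * n%:R + 9) * ternary_bin n.+1 (2 * k)
    - 7 * n.+1%:R * ternary_bin n (2 * k))).
    by ring.
  case: (k : nat) => [|j].
    by rewrite muln0 ternary_bin_rec0 /prev; ring.
  have e : (2 * j.+1)%N = (2 * j).+2 by lia.
  by rewrite /prev e ternary_bin_recS; move: (g _) => ?; ring.
(* The sums cancel after a shift, as [2 (k + 1) g (k + 1) = 16 (2 k + 1) g k]; the extreme terms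
   vanish. *)
rewrite big_ord_recl mulr0 add0r [X in _ - X]big_ord_recr /=.
rewrite [X in _ - (_ + X)](_ : _ = 0) ?addr0; last first.
  by rewrite /ternary_bin bin_small ?mul0r ?mulr0 //; lia.
apply/eqP; rewrite subr_eq0; apply/eqP; apply: eq_bigr => k _.
have -> : bump 0 k = k.+1 by [].
rewrite /prev mulrA; congr (_ * _).
rewrite /g exprS natrM -!natr1 natrM.
have := central_bin_rec k; rewrite -natr1 => H.
transitivity (8 * 4 ^+ k * ((k%:R + 1) * 'C(2 * k.+1, k.+1)%:R) : rat); first ring.
by rewrite H; ring.
Qed.

(** Behind this is [W = (1 + x) / sqrt_prod], with [1 / sqrt_prod] generating the central
    trinomials; the proof compares recurrences. *)
Lemma sqrt_ratio_trinomial m :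
  coefs sqrt_ratio m.+1 = central_trinomial m.+1 + central_trinomial m.
Proof.
pose v n := if n is m.+1 then central_trinomial m.+1 + central_trinomial m else 1.
have t0 : central_trinomial 0 = 1.
  rewrite /central_trinomial big_ord_recr big_ord0 /ternary_bin.
  by apply/eqP; vm_compute.
have t1 : central_trinomial 1 = 3.
  rewrite /central_trinomial !big_ord_recr big_ord0 /ternary_bin.
  by apply/eqP; vm_compute.
apply: (ode_rec_unique (coefs sqrt_ratio) v sqrt_ratio_rec _ _ _ m.+1) => //.
- case=> [|n]; rewrite /v.
    by have := central_trinomial_rec 0; rewrite t0 t1 => H; rewrite mulrDr H; ring.
  rewrite mulrDr central_trinomial_rec.
  have := central_trinomial_rec n => /eqP; rewrite -subr_eq0 => /eqP H.
  by apply/eqP; rewrite -subr_eq0 -H -!natr1; apply/eqP; ring.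
- by rewrite sqrt_ratio1 /v /= t0 t1; ring.
Qed.

(** With [n = m + 1], ['C(m, 2k) = (1 - 2k/n) 'C(n, 2k)], and [3 + (1 - 2k/n) = 2 (2 - k/n)]. *)
Lemma trinomial_sum m :
  central_trinomial m.+1 + central_trinomial m =
  \sum_(0 <= k < m.+2) ('C(m.+1, 2 * k))%:R * ('C(2 * k, k))%:R
     * 2 ^+ (2 * k + 1) * 3 ^ (m.+1%:Z - 2 * k%:Z - 1)
     * (2 - k%:R / m.+1%:R) :> rat.
Proof.
rewrite big_mkord (central_trinomialE m m.+2) // /central_trinomial -big_split /=.
apply: eq_bigr => k _; rewrite /ternary_bin.
have nz : m.+1%:R != 0 :> rat by rewrite Num.Theory.pnatr_eq0.
have nz3 : 3 ^+ (2 * k) != 0 :> rat by rewrite expf_neq0.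
(* The integer exponent is [-1] at [2k = m + 1], where the term need not vanish. *)
have -> : 3 ^ (m.+1%:Z - 2 * k%:Z - 1) = 3 ^+ m / 3 ^+ (2 * k) :> rat.
  have -> : m.+1%:Z - 2 * k%:Z - 1 = m%:Z - (2 * k)%N%:Z by lia.
  by rewrite expfzDr // -exprnN.
have -> : 'C(m, 2 * k)%:R =
    (m.+1%:R - (2 * k)%:R) * 'C(m.+1, 2 * k)%:R / m.+1%:R :> rat.
  by rewrite -mul_bin_down_rat mulrAC divff // mul1r.
have -> : 4 ^+ k = 2 ^+ (2 * k) :> rat
  by rewrite exprM; congr (_ ^+ _); ring.
rewrite addn1 !exprS natrM; field.
by rewrite nat1r nz nz3.
Qed.

Theorem theorem15 :
  let x : fps rat := fpsX in
  [/\ forall k : nat,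
        (Fps (fun n : nat => (pop2_count (2 * n + k + 1)%N (n + k)%N)%:R : rat))%:F
        = (fps_sqrt ((1 + x) / (1 - 7 * x)))%:F *
          ((1 - x - fps_sqrt ((1 + x) * (1 - 7 * x)))%:F / (2 * x)%:F) ^+ k,
      forall k : nat,
        (Fps (fun n : nat => (pop2_count (2 * n + k + 1)%N n)%:R : rat))%:F
        = (fps_sqrt ((1 + x) / (1 - 7 * x)))%:F *
          ((1 - x - fps_sqrt ((1 + x) * (1 - 7 * x)))%:F /
             (2 * x * (1 + 2 * x))%:F) ^+ k
    & forall n : nat, (1 <= n)%N ->
        (pop2_count (2 * n + 1)%N n)%:R
          = \sum_(0 <= i < n) (-1) ^+ i * 2 ^+ (n - i)
              * ('C(2 * (n - i), n - i))%:R * ('C(n - 1, i))%:R :> rat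
        /\
        \sum_(0 <= i < n) (-1) ^+ i * 2 ^+ (n - i)
            * ('C(2 * (n - i), n - i))%:R * ('C(n - 1, i))%:R
          = \sum_(0 <= k < n.+1) ('C(n, 2 * k))%:R * ('C(2 * k, k))%:R
              * 2 ^+ (2 * k + 1) * 3 ^ (n%:Z - 2 * k%:Z - 1)
              * (2 - k%:R / n%:R) :> rat].
Proof.
move=> x; split=> [k|k|[//|m] _].
- rewrite -/sqrt_ratio -/sqrt_prod -[2 * x]mulr1 tofrac_quad_root ?unitr1 // divr1.
  rewrite -tofracXn -tofracM -diag_aboveE; congr tofrac.
  by apply: fpsP => n /=; rewrite pop2_count_above.
- rewrite -/sqrt_ratio -/sqrt_prod tofrac_quad_root ?one2X_unit //.
  rewrite -tofracXn -tofracM -diag_belowE; congr tofrac.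
  by apply: fpsP => n /=; rewrite pop2_count_below.
rewrite -alt_sum_rev -trinomial_sum -sqrt_ratio_trinomial -sqrt_ratio_alt_sum.
(* The central numbers are the diagonal [k = 0], whose series is [sqrt_ratio] itself. *)
split=> //; have := diag_aboveE 0; rewrite expr0 mulr1 => <- /=.
by rewrite -pop2_count_above !addn0.
Qed.
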